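(* Let $a,r,s,K>0$ and $\nu_x,\nu_y\in\mathbb{R}$ with $\nu_x>0$ and $|\nu_x|\ge|\nu_y|$. Consider the system $$\dot x=\nu_x-K\{a(1+r)\sin x+\sin y\},\qquad \dot y=\nu_y-K\{a\sin x+(1+s)\sin y\}$$ on the torus $\mathbb{T}^2=(\mathbb{R}/2\pi\mathbb{Z})^2$, and put $$K_4=\max\left(\frac{(1+s)\nu_x-\nu_y}{a(r+s+rs)},\ \frac{|\nu_x-(1+r)\nu_y|}{r+s+rs}\right).$$ The fixed points $(x,y)=(x_1,y_1),\ (x_1,y_2),\ (x_2,y_1),\ (x_2,y_2)$ exist if and only if $K\ge K_4$, where $$x_1=\arcsin\frac{(1+s)\nu_x-\nu_y}{(r+s+rs)aK},\quad y_1=\arcsin\frac{(1+r)\nu_y-\nu_x}{(r+s+rs)K},\quad x_2=\pi-x_1,\quad y_2=\pi-y_1,$$ with $-\tfrac{\pi}{2}\le x_1\le\tfrac{\pi}{2}$ and $-\tfrac{\pi}{2}\le y_1\le\tfrac{\pi}{2}$. These points correspond to two different fixed points for $K=K_4$ and to four different fixed points for $K>K_4$. For $K>K_4$, in terms of linear stability, $(x_1,y_1)$ is a sink, $(x_1,y_2)$ and $(x_2,y_1)$ are saddles, and $(x_2,y_2)$ is a source; in particular, a stable fixed point (full synchrony) exists for $K>K_4$.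
   Context: A fixed point is called, in terms of linear stability, a sink if both eigenvalues of the Jacobian matrix there have negative real part, a source if both have positive real part, and a saddle if the eigenvalues are real with opposite signs. Here $x$ and $y$ are the phase differences $\phi_A-\phi_B$ and $\phi_C-\phi_B$ of three coupled oscillators A, B, C, and full synchrony of the three oscillators is realized when the system has a stable fixed point.
   Formalization: At K=K_4 the claim of two different fixed points is stated only when the two entries of the max are different; when they are equal (e.g. a=2, r=s=1, ν_x=1, ν_y=0, K=1/3) the four points coincide, and exactly one fixed point is asserted instead. *)

(* Defs.v *)
From HB Require Import structures.
From mathcomp Require Import all_boot all_order all_algebra.
From mathcomp Require Import ring_quotient complex.
From mathcomp Require Import all_classical all_reals all_analysis.

Set Implicit Arguments.
Unset Strict Implicit.
Unset Printing Implicit Defensive.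

Import Order.TTheory GRing.Theory Num.Theory.
Import numFieldNormedType.Exports.

Local Open Scope classical_set_scope.
Local Open Scope ring_scope.

Definition two_pi_int (R : realType) : {pred R} :=
  [pred t | t / (2 * pi) \is a Num.int].
Arguments two_pi_int : clear implicits.

Lemma two_pi_int_zmod_closed (R : realType) : zmod_closed (two_pi_int R).
Proof.
split=> [|x y]; rewrite !inE ?mul0r ?rpred0 // => xZ yZ.
by rewrite mulrBl rpredB.
Qed.

HB.instance Definition _ (R : realType) :=
  GRing.isZmodClosed.Build R (two_pi_int R) (two_pi_int_zmod_closed R).

(* Despite its name, [{ideal_quot I}] only needs the additive subgroup I. *)
Definition circle (R : realType) : Type := {ideal_quot (two_pi_int R)}.

Definition angle (R : realType) (t : R) : circle R :=
  \pi_({ideal_quot (two_pi_int R)})%qT t.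

Definition torus (R : realType) : Type := (circle R * circle R)%type.

Definition vec2 (R : realType) (x y : R) : 'rV[R]_2 :=
  \row_(i < 2) (if i == 0 then x else y).

Definition torus_proj (R : realType) (v : 'rV[R]_2) : torus R :=
  (angle (v 0 0), angle (v 0 1)).

Definition phase_field (R : realType) (a r s K nux nuy : R) (v : 'rV[R]_2) :
    'rV[R]_2 :=
  let x := v 0 0 in
  let y := v 0 1 in
  vec2 (nux - K * (a * (1 + r) * sin x + sin y))
       (nuy - K * (a * sin x + (1 + s) * sin y)).

(* A vector field on the torus is given by a (2 pi)-periodic field F on the
   plane; a notion at a point p of the torus is required at every lift of p. *)

Definition fixed_points (R : realType) (F : 'rV[R]_2 -> 'rV[R]_2) :
    set (torus R) :=
  [set p | forall v, torus_proj v = p -> F v = 0].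

(* ['J F v] acts on row vectors: it is the transpose of the usual matrix of
   partial derivatives, hence it has the same eigenvalues. *)
Definition jacobian_eigenvalue (R : realType) (F : 'rV[R]_2 -> 'rV[R]_2)
    (v : 'rV[R]_2) (z : R[i]) : bool :=
  eigenvalue (map_mx (real_complex R) ('J F v)) z.

Definition sink (R : realType) (F : 'rV[R]_2 -> 'rV[R]_2) (p : torus R) : Prop :=
  fixed_points F p /\
  forall v, torus_proj v = p ->
    differentiable F v /\
    forall z, jacobian_eigenvalue F v z -> complex.Re z < 0.

Definition source (R : realType) (F : 'rV[R]_2 -> 'rV[R]_2) (p : torus R) : Prop :=
  fixed_points F p /\
  forall v, torus_proj v = p ->
    differentiable F v /\
    forall z, jacobian_eigenvalue F v z -> 0 < complex.Re z.

Definition saddle (R : realType) (F : 'rV[R]_2 -> 'rV[R]_2) (p : torus R) : Prop :=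
  fixed_points F p /\
  forall v, torus_proj v = p ->
    differentiable F v /\
    exists l1 l2 : R, [/\ l1 < 0, 0 < l2 &
      forall z, jacobian_eigenvalue F v z <->
        z = real_complex R l1 \/ z = real_complex R l2].

(* Main.v *)
Require Import Defs.
From HB Require Import structures.
From mathcomp Require Import all_boot all_order all_algebra.
From mathcomp Require Import ring_quotient complex ring lra.
From mathcomp Require Import all_classical all_reals all_analysis.

(** On the circle, [sin t = sin u] iff [t] is [u] or [pi - u], and a zero of the
field is a solution of a linear system in [(sin x, sin y)] of determinant
[K^2 a (r + s + r s) <> 0].  Hence fixed points exist iff both values [X], [Y]
prescribed for the sines lie in [[-1, 1]], that is [kx <= K] and [ky <= K]; the
two solutions for [x] coincide iff [|X| = 1], that is [K = kx], and similarly for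
[y].  With [c = cos x] and [d = cos y] the Jacobian has determinant
[K^2 a (r + s + r s) c d], trace [- K (a (1 + r) c + (1 + s) d)] and positive
discriminant when [c d <> 0], so its eigenvalues are real with signs read off
from those of [c] and [d]. *)

Import Order.TTheory GRing.Theory Num.Theory.
Import numFieldNormedType.Exports.

Local Open Scope classical_set_scope.
Local Open Scope card_scope.
Local Open Scope ring_scope.

(** * Sine and cosine as functions on the circle *)

Lemma cos_periodz (R : realType) (t : R) (k : int) :
  cos (t + k%:~R * (2 * pi)) = cos t.
Proof.
have nat_per u n : cos (u + n%:R * (2 * pi)) = cos u :> R.
  by rewrite mulr_natl mulr_natl; exact: (periodicn (@cosD2pi R)).
case: k => n; first exact: nat_per.
(* For a negative multiple, [n.+1] periods are added to the shifted argument and cancel the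
   shift. *)
by rewrite NegzE -[LHS](nat_per _ n.+1) mulrNz mulNr addrNK.
Qed.
Lemma sin_periodz (R : realType) (t : R) (k : int) :
  sin (t + k%:~R * (2 * pi)) = sin t.
Proof. by rewrite -!cosBpihalf -[RHS](cos_periodz _ _ k) addrAC. Qed.

(** Reduce [t] modulo [2 * pi] to [e] in [[0, 2 * pi[]. Injectivity of [cos] on [[0, pi]] settles
    [e <= pi]; beyond [pi], the reflection [2 * pi - e] falls in that interval and would vanish,
    contradicting [e < 2 * pi]. *)
Lemma cos_eq1 (R : realType) (t : R) :
  cos t = 1 -> exists k : int, t = k%:~R * (2 * pi).
Proof.
move=> t1; have pi0 := pi_gt0 R.
pose k := Num.floor (t / (2 * pi)); pose e := t - k%:~R * (2 * pi).
have e1 : cos e = 1.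
  by rewrite -t1 -(cos_periodz _ e k) /e subrK.
have pi2 : 0 < 2 * pi :> R by lra.
have e_ge0 : 0 <= e by rewrite subr_ge0 -ler_pdivlMr// Num.Theory.floor_le_tmp.
have e_lt : e < 2 * pi.
  have := Num.Theory.floorD1_gt (t / (2 * pi)).
  by rewrite intrD ltr_pdivrMr// mulrDl mul1r -ltrBlDl.
exists k; apply/eqP; rewrite -subr_eq0; apply/eqP; rewrite -/e.
have c0 u : 0 <= u <= pi -> cos u = 1 -> u = 0 :> R.
  by move=> u0 u1; apply: (@cos_inj R); rewrite ?in_itv/= ?cos0//; lra.
have [ep|ep] := leP e pi; first by apply: c0; rewrite // e_ge0.
suff: 2 * pi - e = 0 by move=> h; exfalso; lra.
apply: c0; first lra.
have -> : 2 * pi - e = - e + 1%:~R * (2 * pi) by rewrite mulr1z; ring.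
by rewrite cos_periodz cosN.
Qed.

(** Replaces reasoning in the quotient by trigonometry: if cosines and sines agree, then
    [cos (t - u)] is a sum of squares equal to 1, so [cos_eq1] applies. *)
Lemma angle_eqP (R : realType) (t u : R) :
  angle t = angle u <-> cos t = cos u /\ sin t = sin u.
Proof.
have -> : angle t = angle u <-> (t - u) / (2 * pi) \is a Num.int.
  rewrite /angle; split=> [/eqP|h]; first by rewrite -Quotient.idealrBE.
  by apply/eqP; rewrite -Quotient.idealrBE.
have pi2 : 2 * pi != 0 :> R by rewrite mulf_neq0// gt_eqF// pi_gt0.
split=> [/intrP[k /(canRL (divfK pi2)) /(canRL (subrK _)) ->]|[ct st]].
  by rewrite addrC cos_periodz sin_periodz.
have [|k ->] := @cos_eq1 R (t - u); last by rewrite mulfK// intr_int.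
by rewrite cosB ct st -!expr2 cos2Dsin2.
Qed.

(** Equal sines force the cosines to agree up to sign, and [pi - u] realizes the opposite sign. *)
Lemma sin_eqP (R : realType) (t u : R) :
  sin t = sin u <-> angle t = angle u \/ angle t = angle (pi - u).
Proof.
have sinpiB v : sin (pi - v) = sin v :> R by rewrite sinB sinpi cospi; ring.
have cospiB v : cos (pi - v) = - cos v :> R by rewrite cosB sinpi cospi; ring.
split=> [tu|[] /angle_eqP[_ ->]//].
have /eqP : cos t ^+ 2 = cos u ^+ 2 by rewrite !cos2sin2 tu.
rewrite eqf_sqr => /orP[] /eqP cE; [left|right]; apply/angle_eqP => //.
by rewrite cospiB sinpiB.
Qed.

Lemma angle_piB (R : realType) (t : R) :
  angle t = angle (pi - t) <-> cos t = 0.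
Proof.
rewrite angle_eqP cosB sinB sinpi cospi; split=> [[]|->]; [lra|split; ring].
Qed.

Lemma angle_surj (R : realType) (c : circle R) : exists t, angle t = c.
Proof. by exists (repr c); rewrite /angle reprK. Qed.

Lemma vec2E (R : realType) (x y : R) :
  (vec2 x y 0 0 = x) * (vec2 x y 0 1 = y).
Proof. by rewrite !mxE. Qed.

Lemma torus_proj_vec2 (R : realType) (x y : R) :
  torus_proj (vec2 x y) = (angle x, angle y).
Proof. by rewrite /torus_proj !vec2E. Qed.

Lemma card_set_seq (T : choiceType) (s : seq T) :
  uniq s -> [set` s] #= `I_(size s).
Proof.
case: s => [_|x s us]; first by rewrite set_nil II0 card_eq00.
have -> : [set` x :: s] = nth x (x :: s) @` `I_(size (x :: s)).
  apply/seteqP; split=> y /=.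
    by move=> /nthP-/(_ x)[i ilt <-]; exists i.
  by case=> i ilt <-; exact: mem_nth.
apply: inj_card_eq => i j; rewrite !inE /= => ilt jlt /eqP.
by rewrite nth_uniq// => /eqP.
Qed.

(** * Eigenvalues of matrices of size two through trace and determinant *)

Lemma det_mx22 (R : comPzRingType) (A : 'M[R]_2) :
  \det A = A 0 0 * A 1 1 - A 0 1 * A 1 0.
Proof.
rewrite (expand_det_row _ 0) !big_ord_recl big_ord0 /cofactor !det_mx11 !mxE /=.
have -> : lift (0 : 'I_2) (0 : 'I_1) = 1 by exact/val_inj.
have -> : lift (1 : 'I_2) (0 : 'I_1) = 0 by exact/val_inj.
by rewrite addr0 expr0 expr1 mul1r mulN1r mulrN.
Qed.

Lemma mxtrace_mx22 (R : pzRingType) (A : 'M[R]_2) : \tr A = A 0 0 + A 1 1.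
Proof.
rewrite /mxtrace !big_ord_recl big_ord0 addr0.
by have -> : lift ord0 ord0 = 1 :> 'I_2 by exact/val_inj.
Qed.

Lemma eigenvalue_mx22 (F : fieldType) (A : 'M[F]_2) (z : F) :
  eigenvalue A z = (z ^+ 2 - \tr A * z + \det A == 0).
Proof.
rewrite eigenvalue_root_char rootE; congr (_ == 0).
rewrite /char_poly !det_mx22 mxtrace_mx22 !mxE /= mulr1n mulr0n !sub0r.
by rewrite hornerD hornerN !hornerM !hornerD !hornerN !hornerC !hornerX; ring.
Qed.

(** A positive discriminant makes the characteristic polynomial split over the reals with distinct
    roots, so no other complex number is an eigenvalue. *)
Lemma real_mx22_eigenvalues (R : rcfType) (A : 'M[R]_2) :
  4 * \det A < \tr A ^+ 2 ->
  exists l1 l2 : R, [/\ l1 < l2, l1 + l2 = \tr A, l1 * l2 = \det A &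
    forall z, eigenvalue (map_mx (real_complex R) A) z <->
      z = real_complex R l1 \/ z = real_complex R l2].
Proof.
move=> disc; set t := \tr A; set d := \det A; pose q := Num.sqrt (t ^+ 2 - 4 * d).
have q0 : 0 < q by rewrite sqrtr_gt0 subr_gt0.
have q2 : q ^+ 2 = t ^+ 2 - 4 * d by rewrite sqr_sqrtr// subr_ge0 ltW.
have sumE : (t - q) / 2 + (t + q) / 2 = t by field.
have prodE : (t - q) / 2 * ((t + q) / 2) = d.
  have -> : (t - q) / 2 * ((t + q) / 2) = (t ^+ 2 - q ^+ 2) / 4 by field.
  by rewrite q2; field.
exists ((t - q) / 2), ((t + q) / 2); split=> //; first lra.
move=> z; rewrite eigenvalue_mx22 det_map_mx trace_map_mx -/t -/d.
(* With the roots abstracted and trace and determinant replaced by their sum and product, the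
   polynomial visibly factors. *)
move: (_ / 2) (_ / 2) sumE prodE => l2 l1 <- <-.
rewrite rmorphD rmorphM /=.
set c1 := real_complex R l1; set c2 := real_complex R l2.
have -> : z ^+ 2 - (c1 + c2) * z + c1 * c2 = (z - c1) * (z - c2) by ring.
by rewrite mulf_eq0 !subr_eq0; split=> [/orP[]/eqP->|[]->];
  rewrite ?eqxx ?orbT//; [left|right].
Qed.

(** * Differential and Jacobian of the field *)

Lemma is_diff_sin_coord (R : realType) (v : 'rV[R]_2) (j : 'I_2) :
  is_diff v (fun u : 'rV[R]_2 => sin (u 0 j) : R)
    (fun w => w 0 j * cos (v 0 j)).
Proof.
have sin_diff : differentiable (@sin R) (v 0 j).
  exact/derivable1_diffP/derivable_sin.
have coord_diff := @differentiable_coord R _ _ v 0 j.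
have dcoord : 'd (fun u : 'rV[R]_2 => u 0 j : R) v = (fun w => w 0 j) :> (_ -> _).
  (* Packing the coordinate map as a continuous linear map makes it its own differential. *)
  have @f : {linear 'rV[R]_2 -> R}.
    by exists (fun w : 'rV[R]_2 => w 0 j); do 2![eexists]; do ?[constructor];
      rewrite ?mxE// => ? *; rewrite ?mxE//; move=> ?; rewrite !mxE.
  by rewrite (_ : (fun _ => _) = f)// diff_lin//; exact: coord_continuous.
apply: DiffDef; first exact: (differentiable_comp coord_diff).
rewrite (diff_comp coord_diff)// dcoord diff1E//=; apply/funext => w /=.
by rewrite derive1E (derive_val (f := @sin R)).
Qed.

(** The field is a constant plus [sin x] and [sin y] times fixed vectors, so only the two sines have
    to be differentiated. *)
Lemma is_diff_phase_field (R : realType) (a r s K nux nuy : R) (v : 'rV[R]_2) :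
  is_diff v (phase_field a r s K nux nuy)
    (fun w => vec2
      (- K * (a * (1 + r) * (w 0 0 * cos (v 0 0)) + w 0 1 * cos (v 0 1)))
      (- K * (a * (w 0 0 * cos (v 0 0)) + (1 + s) * (w 0 1 * cos (v 0 1))))).
Proof.
have dx := is_diff_sin_coord _ v 0; have dy := is_diff_sin_coord _ v 1.
pose S j (u : 'rV[R]_2) : R := sin (u 0 j).
have FE : phase_field a r s K nux nuy =
    cst (vec2 nux nuy) +
    ((fun u => S 0 u *: vec2 (- K * (a * (1 + r))) (- K * a)) +
     (fun u => S 1 u *: vec2 (- K) (- K * (1 + s)))).
  apply/funext => u; apply/rowP => i; rewrite !mxE /S.
  by case: ifP => _; ring.
have dZ j (f : 'rV[R]_2) : is_diff v (fun u => S j u *: f)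
    (fun w => (w 0 j * cos (v 0 j)) *: f).
  have dS := is_diff_sin_coord _ v j.
  apply: DiffDef; first exact: differentiableZl.
  by rewrite diffZl// diff_val.
have dsum := is_diffD (is_diff_cst (vec2 nux nuy) v)
  (is_diffD (dZ 0 (vec2 (- K * (a * (1 + r))) (- K * a)))
            (dZ 1 (vec2 (- K) (- K * (1 + s))))).
rewrite FE; apply: (is_diff_eq dsum); apply/funext => w; apply/rowP => i.
by rewrite !mxE; case: ifP => _; ring.
Qed.

Lemma jacobian_phase_field (R : realType) (a r s K nux nuy : R) (v : 'rV[R]_2) :
  'J (phase_field a r s K nux nuy) v = \matrix_(i, j)
    (- K * (if i == 0 then a * (if j == 0 then 1 + r else 1) * cos (v 0 0)
            else (if j == 0 then 1 else 1 + s) * cos (v 0 1))).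
Proof.
have dF := is_diff_phase_field _ a r s K nux nuy v.
apply/matrixP => i j; rewrite /jacobian !mxE diff_val !mxE.
by case: i => [[|[|//]] ?]; case: j => [[|[|//]] ?] /=; ring.
Qed.

(** * Counting the points of a grid with possible coincidences *)

Lemma set_undup (T : eqType) (s : seq T) : [set` undup s] = [set` s].
Proof. by apply/seteqP; split=> x; rewrite /= mem_undup. Qed.

(** The four pairs form a product of two sets, so coincidences in the two coordinates act
    independently and the counts multiply. *)
Lemma card_grid (T U : choiceType) (a1 a2 : T) (b1 b2 : U) :
  [set (a1, b1); (a1, b2); (a2, b1); (a2, b2)] #=
    `I_((if a1 == a2 then 1 else 2) * (if b1 == b2 then 1 else 2)).
Proof.
have -> : [set (a1, b1); (a1, b2); (a2, b1); (a2, b2)] =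
    [set` undup [:: (a1, b1); (a1, b2); (a2, b1); (a2, b2)]].
  rewrite set_undup; apply/seteqP; split=> p /=; rewrite !inE.
    by move=> [[[|]|]|] ->; rewrite eqxx ?orbT.
  by move=> /or4P[] /eqP ->; [left; left; left|left; left; right|left; right|right].
set n := (_ * _)%N; set s := undup _.
suff <- : size s = n by exact: card_set_seq (undup_uniq _).
rewrite /s /n /= !inE !xpair_eqE !eqxx.
by case: (a1 == a2); case: (b1 == b2); rewrite ?orbT.
Qed.

(** * Zeros of the field and fixed points on the torus *)

Lemma phase_field_eq0 (R : realType) (a r s K nux nuy : R) (v : 'rV[R]_2) :
  0 < a -> 0 < r -> 0 < s -> 0 < K ->
  phase_field a r s K nux nuy v = 0 <->
  sin (v 0 0) = ((1 + s) * nux - nuy) / ((r + s + r * s) * a * K) /\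
  sin (v 0 1) = ((1 + r) * nuy - nux) / ((r + s + r * s) * K).
Proof.
move=> a0 r0 s0 K0; have rs0 : 0 < r * s by rewrite mulr_gt0.
have a_neq0 : a != 0 by lra.
have K_neq0 : K != 0 by lra.
have d_neq0 : r + s + r * s != 0 by lra.
set x := sin _; set y := sin _.
have -> : phase_field a r s K nux nuy v = 0 <->
    nux = K * (a * (1 + r) * x + y) /\ nuy = K * (a * x + (1 + s) * y).
  split=> [/rowP F0|[/eqP xE /eqP yE]].
    by have := (F0 0, F0 1); rewrite !mxE /= => -[/eqP + /eqP];
      rewrite !subr_eq0 => /eqP xE /eqP yE.
  apply/rowP => i; rewrite !mxE -/x -/y.
  by case: ifP => _; apply/eqP; rewrite subr_eq0.
(* This is Cramer's rule, where [r + s + r * s] arises as [(1 + r) * (1 + s) - 1]. *)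
split=> [[-> ->]|[-> ->]].
  by split; field; rewrite ?a_neq0 ?K_neq0 ?d_neq0.
by split; field; rewrite ?a_neq0 ?K_neq0 ?d_neq0.
Qed.

(** The field sees a lift only through its sines, which the angles determine; one lift therefore
    decides for all. *)
Lemma fixed_points_torus_proj (R : realType) (a r s K nux nuy : R)
    (v : 'rV[R]_2) :
  fixed_points (phase_field a r s K nux nuy) (torus_proj v) <->
  phase_field a r s K nux nuy v = 0.
Proof.
split=> [|Fv u [/angle_eqP[_ xE] /angle_eqP[_ yE]]]; first exact.
by rewrite -Fv /phase_field xE yE.
Qed.

(** * Linear stability from the signs of the cosines *)

Lemma phase_field_spectrum (R : realType) (a r s K nux nuy : R)
    (v : 'rV[R]_2) :
  let c := cos (v 0 0) in let d := cos (v 0 1) in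
  0 < a -> 0 < r -> 0 < s -> 0 < K -> c * d != 0 ->
  exists l1 l2 : R, [/\ l1 < l2,
    l1 + l2 = - K * (a * (1 + r) * c + (1 + s) * d),
    l1 * l2 = K ^+ 2 * a * (r + s + r * s) * (c * d) &
    forall z, jacobian_eigenvalue (phase_field a r s K nux nuy) v z <->
      z = real_complex R l1 \/ z = real_complex R l2].
Proof.
move=> c d a0 r0 s0 K0 cd_neq0.
have rs0 : 0 < r * s by rewrite mulr_gt0.
set J := 'J (phase_field a r s K nux nuy) v.
have trE : \tr J = - K * (a * (1 + r) * c + (1 + s) * d).
  by rewrite mxtrace_mx22 /J jacobian_phase_field !mxE /= -/c -/d; ring.
have detE : \det J = K ^+ 2 * a * (r + s + r * s) * (c * d).
  by rewrite det_mx22 /J jacobian_phase_field !mxE /= -/c -/d; ring.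
rewrite -trE -detE; apply: real_mx22_eigenvalues.
rewrite trE detE -subr_gt0.
(* When [c * d > 0] the discriminant is a square plus [4 a K^2 c d]; when
   [c * d < 0] the determinant is negative. *)
have K2 : 0 < K ^+ 2 by rewrite exprn_gt0.
have [cd_lt0|cd_gt0|cd0] := ltgtP (c * d) 0; last by rewrite cd0 eqxx in cd_neq0.
  rewrite subr_gt0; apply: (@lt_le_trans _ _ 0); last exact: sqr_ge0.
  by rewrite pmulr_rlt0// pmulr_rlt0// !mulr_gt0//; lra.
rewrite (_ : _ - _ = K ^+ 2 * ((a * (1 + r) * c - (1 + s) * d) ^+ 2 +
  4 * a * (c * d))); last by ring.
by rewrite mulr_gt0// ltr_wpDl ?sqr_ge0// mulr_gt0// mulr_gt0.
Qed.

Lemma phase_field_stability (R : realType) (a r s K nux nuy x y : R) :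
  let F := phase_field a r s K nux nuy in
  let p := torus_proj (vec2 x y) in
  0 < a -> 0 < r -> 0 < s -> 0 < K -> fixed_points F p ->
  [/\ 0 < cos x -> 0 < cos y -> sink F p,
      cos x * cos y < 0 -> saddle F p &
      cos x < 0 -> cos y < 0 -> source F p].
Proof.
move=> F p a0 r0 s0 K0 Fp; have rs0 : 0 < r * s by rewrite mulr_gt0.
have dF v : differentiable F v.
  by have dFv := is_diff_phase_field _ a r s K nux nuy v; exact: ex_diff.
have coef_gt0 : 0 < K ^+ 2 * a * (r + s + r * s).
  by rewrite mulr_gt0//; [rewrite mulr_gt0// exprn_gt0|lra].
(* Cosines depend only on the angles, so one description of the spectrum by [cos x] and [cos y]
   serves every lift of [p]. *)
have lift_spec v : torus_proj v = p -> cos x * cos y != 0 ->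
    exists l1 l2 : R, [/\ l1 < l2,
      l1 + l2 = - K * (a * (1 + r) * cos x + (1 + s) * cos y),
      l1 * l2 = K ^+ 2 * a * (r + s + r * s) * (cos x * cos y) &
      forall z, jacobian_eigenvalue F v z <->
        z = real_complex R l1 \/ z = real_complex R l2].
  rewrite /p torus_proj_vec2 => -[/angle_eqP[<- _] /angle_eqP[<- _]] cd.
  exact: phase_field_spectrum.
have tr_gt0 c d : 0 < c -> 0 < d -> 0 < K * (a * (1 + r) * c + (1 + s) * d).
  by move=> c0 d0; rewrite mulr_gt0// addr_gt0// !mulr_gt0//; lra.
split=> [cx cy|cxy|cx cy]; split=> // v vp; split=> //.
- have cxy : 0 < cos x * cos y by rewrite mulr_gt0.
  have [|l1 [l2 [l12 sumE prodE spec]]] := lift_spec v vp; first by rewrite gt_eqF.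
  have l12_gt0 : 0 < l1 * l2 by rewrite prodE mulr_gt0.
  have l12_lt0 : l1 + l2 < 0 by rewrite sumE mulNr oppr_lt0 tr_gt0.
  by move=> z /spec[] ->/=; nra.
- have [|l1 [l2 [l12 sumE prodE spec]]] := lift_spec v vp; first by rewrite lt_eqF.
  have l12_lt0 : l1 * l2 < 0 by rewrite prodE pmulr_rlt0.
  by exists l1, l2; split=> //; nra.
- have cxy : 0 < cos x * cos y by rewrite nmulr_rgt0.
  have [|l1 [l2 [l12 sumE prodE spec]]] := lift_spec v vp; first by rewrite gt_eqF.
  have l12_gt0 : 0 < l1 * l2 by rewrite prodE mulr_gt0.
  have l12_lt0 : 0 < l1 + l2.
    (* Moving the sign onto the cosines allows [tr_gt0] to be reused. *)
    have -> : l1 + l2 = K * (a * (1 + r) * - cos x + (1 + s) * - cos y).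
      by rewrite sumE; ring.
    by rewrite tr_gt0// oppr_gt0.
  by move=> z /spec[] ->/=; nra.
Qed.

(** * Solving a sine equation on the circle with [asin] *)

Lemma sin_solutions (R : realType) (q t : R) : `|q| <= 1 ->
  sin t = q <-> angle t = angle (asin q) \/ angle t = angle (pi - asin q).
Proof.
by rewrite ler_norml => q1; rewrite -sin_eqP asinK// in_itv.
Qed.

Lemma cos_asin_gt0 (R : realType) (q : R) : `|q| < 1 -> 0 < cos (asin q).
Proof.
move=> q1; have := q1; rewrite ltr_norml => /andP[qm qM].
rewrite cos_asin; last by rewrite !ltW.
by rewrite sqrtr_gt0 subr_gt0 -real_normK ?num_real// expr_lt1.
Qed.

(** The two solutions merge exactly when [cos (asin q)], the square root of [1 - q ^+ 2],
    vanishes. *)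
Lemma angle_asin_eq (R : realType) (q : R) : `|q| <= 1 ->
  angle (asin q) = angle (pi - asin q) <-> `|q| = 1.
Proof.
rewrite angle_piB le_eqVlt => /orP[/eqP q1|q1].
  split=> // _; rewrite cos_asin; last by rewrite -ler_norml q1.
  by rewrite -real_normK ?num_real// q1 expr1n subrr sqrtr0.
split=> [c0|q1']; last by rewrite q1' ltxx in q1.
by have := cos_asin_gt0 _ _ q1; rewrite c0 ltxx.
Qed.

Theorem mainTheorem2 (R : realType) (a r s K nux nuy : R)
    (a_gt0 : 0 < a) (r_gt0 : 0 < r) (s_gt0 : 0 < s) (K_gt0 : 0 < K)
    (nux_gt0 : 0 < nux) (nuy_le_nux : `|nuy| <= `|nux|) :
  let F := phase_field a r s K nux nuy in
  let kx := ((1 + s) * nux - nuy) / (a * (r + s + r * s)) in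
  let ky := `|nux - (1 + r) * nuy| / (r + s + r * s) in
  let K4 := Num.max kx ky in
  let x1 := asin (((1 + s) * nux - nuy) / ((r + s + r * s) * a * K)) in
  let y1 := asin (((1 + r) * nuy - nux) / ((r + s + r * s) * K)) in
  let x2 := pi - x1 in
  let y2 := pi - y1 in
  let p11 := torus_proj (vec2 x1 y1) in
  let p12 := torus_proj (vec2 x1 y2) in
  let p21 := torus_proj (vec2 x2 y1) in
  let p22 := torus_proj (vec2 x2 y2) in
  [/\ (* these fixed points exist iff K >= K4, and they are all the fixed points *)
      [/\ [set p11; p12; p21; p22] `<=` fixed_points F <-> K4 <= K,
          fixed_points F !=set0 <-> K4 <= K &
          K4 <= K ->
            [/\ - (pi / 2) <= x1 <= pi / 2,
                - (pi / 2) <= y1 <= pi / 2 &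
                fixed_points F = [set p11; p12; p21; p22]]],
      (* if kx = ky, then x1 = x2 and y1 = y2 modulo 2 pi when K = K4, so that
         the four points collapse to one *)
      K = K4 -> (kx <> ky -> fixed_points F #= `I_2) /\
                (kx = ky -> fixed_points F #= `I_1),
      K4 < K -> fixed_points F #= `I_4,
      K4 < K -> [/\ sink F p11, saddle F p12, saddle F p21 & source F p22] &
      K4 < K -> exists p, sink F p].
Proof.
move=> F kx ky K4 x1 y1 x2 y2 p11 p12 p21 p22.
pose X := ((1 + s) * nux - nuy) / ((r + s + r * s) * a * K).
pose Y := ((1 + r) * nuy - nux) / ((r + s + r * s) * K).
have rs_gt0 : 0 < r * s by rewrite mulr_gt0.
have d_gt0 : 0 < r + s + r * s by lra.
have normX : `|X| = kx / K.
  (* The chain [nuy <= nux < (1 + s) * nux] explains why [kx], unlike [ky], carries no absolute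
     value. *)
  have num_gt0 : 0 < (1 + s) * nux - nuy.
    rewrite subr_gt0 (le_lt_trans (ler_norm _))// (le_lt_trans nuy_le_nux)//.
    by rewrite gtr0_norm// mulrDl mul1r ltrDl mulr_gt0.
  rewrite gtr0_norm; first by rewrite /X /kx; field; rewrite !gt_eqF.
  by rewrite divr_gt0// !mulr_gt0.
have normY : `|Y| = ky / K.
  rewrite /Y /ky normrM normfV distrC (gtr0_norm (mulr_gt0 d_gt0 K_gt0)).
  by field; rewrite !gt_eqF.
have X_le1 : (`|X| <= 1) = (kx <= K) by rewrite normX ler_pdivrMr// mul1r.
have Y_le1 : (`|Y| <= 1) = (ky <= K) by rewrite normY ler_pdivrMr// mul1r.
have X_lt1 : (`|X| < 1) = (kx < K) by rewrite normX ltr_pdivrMr// mul1r.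
have Y_lt1 : (`|Y| < 1) = (ky < K) by rewrite normY ltr_pdivrMr// mul1r.
have fixedE x y : fixed_points F (torus_proj (vec2 x y)) <-> sin x = X /\ sin y = Y.
  by rewrite fixed_points_torus_proj phase_field_eq0// !vec2E.
have torusP p : exists x y : R, p = torus_proj (vec2 x y).
  case: p => cx cy; have [x <-] := angle_surj _ cx; have [y <-] := angle_surj _ cy.
  by exists x, y; rewrite torus_proj_vec2.
have fixed_ne0 p : fixed_points F p -> K4 <= K.
  have [x [y ->]] := torusP p; move=> /fixedE[xX yY].
  by rewrite ge_max -X_le1 -Y_le1 -xX -yY !sin_max.
have gridE : [set p11; p12; p21; p22] =
    [set (angle x1, angle y1); (angle x1, angle y2);
         (angle x2, angle y1); (angle x2, angle y2)].
  by rewrite /p11 /p12 /p21 /p22 !torus_proj_vec2.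
have fixed_grid : K4 <= K -> fixed_points F = [set p11; p12; p21; p22].
  rewrite ge_max -X_le1 -Y_le1 => /andP[X1 Y1]; rewrite gridE.
  apply/seteqP; split=> p; have [x [y ->]] := torusP p.
    move=> /fixedE[/(sin_solutions _ _ _ X1) xE /(sin_solutions _ _ _ Y1) yE].
    rewrite torus_proj_vec2 /=; case: xE => ->; case: yE => ->.
    - by left; left; left.
    - by left; left; right.
    - by left; right.
    - by right.
  rewrite fixedE torus_proj_vec2 (sin_solutions _ _ _ X1) (sin_solutions _ _ _ Y1).
  by move=> [[[|]|]|] [-> ->]; split; by [left|right].
have card_fixed : K4 <= K -> fixed_points F #=
    `I_((if kx == K then 1 else 2) * (if ky == K then 1 else 2)).
  move=> K4K; rewrite fixed_grid// gridE.
  move: K4K; rewrite ge_max -X_le1 -Y_le1 => /andP[X1 Y1].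
  (* With [normX] and [normY], this turns the merging criterion for the angles into [kx = K] and
     [ky = K]. *)
  have eq1 k : (k / K == 1) = (k == K).
    by rewrite -[RHS](inj_eq (mulIf (invr_neq0 (lt0r_neq0 K_gt0)))) divff ?lt0r_neq0.
  have -> : (kx == K) = (angle x1 == angle x2).
    by rewrite -eq1 -normX; apply/eqP/eqP => /(angle_asin_eq _ _ X1).
  have -> : (ky == K) = (angle y1 == angle y2).
    by rewrite -eq1 -normY; apply/eqP/eqP => /(angle_asin_eq _ _ Y1).
  exact: card_grid.
have stability : K4 < K ->
    [/\ sink F p11, saddle F p12, saddle F p21 & source F p22].
  move=> K4K; have fixed_p := fixed_grid (ltW K4K).
  move: K4K; rewrite gt_max -X_lt1 -Y_lt1 => /andP[X1 Y1].
  have cx1 := cos_asin_gt0 _ _ X1; have cy1 := cos_asin_gt0 _ _ Y1.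
  (* Passing from [x1] to [x2] or from [y1] to [y2] flips one cosine, which was positive; this gives
     the sign pattern of the four points. *)
  have cos_piB t : cos (pi - t) = - cos t :> R by rewrite cosB sinpi cospi; ring.
  have stab x y : fixed_points F (torus_proj (vec2 x y)) -> _ :=
    phase_field_stability _ _ _ _ _ _ _ x y a_gt0 r_gt0 s_gt0 K_gt0.
  split.
  - have [|+ _ _] := stab x1 y1; last exact.
    by rewrite fixed_p; left; left; left.
  - have [|_ + _] := stab x1 y2; first by rewrite fixed_p; left; left; right.
    by apply; rewrite cos_piB mulrN oppr_lt0 mulr_gt0.
  - have [|_ + _] := stab x2 y1; first by rewrite fixed_p; left; right.
    by apply; rewrite cos_piB mulNr oppr_lt0 mulr_gt0.
  - have [|_ _ +] := stab x2 y2; first by rewrite fixed_p; right.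
    by apply; rewrite cos_piB oppr_lt0.
split=> //.
- split.
  + by split=> [sub|/fixed_grid->//]; apply: (fixed_ne0 p11); apply: sub;
      left; left; left.
  + split=> [[p]|/fixed_grid->]; first exact: fixed_ne0.
    by exists p11; left; left; left.
  + move=> K4K; split; last exact: fixed_grid.
      move: K4K; rewrite ge_max -X_le1 => /andP[+ _]; rewrite ler_norml => X1.
      by rewrite asin_geNpi2 ?asin_lepi2.
    move: K4K; rewrite ge_max -Y_le1 => /andP[_]; rewrite ler_norml => Y1.
    by rewrite asin_geNpi2 ?asin_lepi2.
- move=> KE; have := card_fixed; rewrite -KE lexx => /(_ isT) cardF.
  have kxK : kx <= K by rewrite KE le_max lexx.
  have kyK : ky <= K by rewrite KE le_max lexx orbT.
  (* A maximum is attained, so at least one factor of the count is 1; the other is 1 as well exactly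
     when [kx = ky]. *)
  have attained : (kx == K) || (ky == K).
    by rewrite KE /K4 /Num.max; case: ifP => _; rewrite eqxx ?orbT.
  split=> kxy; move: attained cardF.
    by case: eqP => kxE; case: eqP => kyE //; case: kxy; rewrite kxE kyE.
  by rewrite kxy orbb => ->.
- move=> K4K; have := card_fixed (ltW K4K).
  by move: K4K; rewrite gt_max => /andP[/lt_eqF-> /lt_eqF->].
- by move=> /stability[? _ _ _]; exists p11.
Qed.
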